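(* Let $\mathcal{G}$ be a $\chi$-bounded class of graphs. If $\mathcal{G}$ has a polynomial $\chi$-bounding function, then so does $\mathcal{G}^*$.
   Context: All graphs are finite and simple, possibly empty; $\omega$ is the clique number and $\chi$ the chromatic number. A class $\mathcal{G}$ is $\chi$-bounded if there is $f:\mathbb{N}\rightarrow\mathbb{R}$ (a $\chi$-bounding function) such that for all $G\in\mathcal{G}$ and all (possibly empty) induced subgraphs $H$ of $G$, $\chi(H)\leq f(\omega(H))$. Given non-empty graphs $G_1,G_2$ with disjoint vertex sets and $u\in V_{G_1}$, the graph obtained by substituting $G_2$ for $u$ in $G_1$ has vertex set $(V_{G_1}\smallsetminus\{u\})\cup V_{G_2}$, induces $G_1\smallsetminus u$ and $G_2$ on the respective parts, and each $v\in V_{G_1}\smallsetminus\{u\}$ is complete to $V_{G_2}$ if $v$ is adjacent to $u$ and anti-complete to $V_{G_2}$ otherwise. $\mathcal{G}^*$ denotes the closure of $\mathcal{G}$ under taking disjoint unions and substitution. *)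

(* Defs.v *)
From HB Require Import structures.
From mathcomp Require Import all_boot all_order all_algebra reals.

Set Implicit Arguments.
Unset Strict Implicit.
Unset Printing Implicit Defensive.

Import Order.TTheory GRing.Theory Num.Theory.
Local Open Scope ring_scope.

Record sgraph : Type := SGraph {
  vertex :> finType;
  adj : rel vertex;
  adj_sym : symmetric adj;
  adj_irrefl : irreflexive adj }.

Definition isomorphic (G H : sgraph) : Prop :=
  exists2 h : G -> H, bijective h & forall x y, adj (h x) (h y) = adj x y.

Section Induced.
Variables (G : sgraph) (A : {set G}).

Definition induced_adj : rel {x : G | x \in A} :=
  fun x y => adj (val x) (val y).

Fact induced_sym : symmetric induced_adj.
Proof. by move=> x y; exact: adj_sym. Qed.

Fact induced_irrefl : irreflexive induced_adj.
Proof. by move=> x; exact: adj_irrefl. Qed.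

Definition induced : sgraph := SGraph induced_sym induced_irrefl.
End Induced.

Definition clique (G : sgraph) (A : {set G}) : bool :=
  [forall x in A, forall y in A, (x != y) ==> adj x y].

Definition omega (G : sgraph) : nat := (\max_(A : {set G} | clique A) #|A|)%N.

Definition proper_coloring (G : sgraph) (k : nat) (c : {ffun G -> 'I_k}) : bool :=
  [forall x, forall y, adj x y ==> (c x != c y)].

Definition colorable (G : sgraph) (k : nat) : bool :=
  [exists c : {ffun G -> 'I_k}, proper_coloring c].

Fact colorable_card (G : sgraph) : exists k, colorable G k.
Proof.
exists #|G|; apply/existsP; exists [ffun x => enum_rank x].
apply/forallP => x; apply/forallP => y; apply/implyP => xy.
rewrite !ffunE (inj_eq enum_rank_inj).
by apply: contraTneq xy => ->; rewrite adj_irrefl.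
Qed.

Definition chi (G : sgraph) : nat := ex_minn (colorable_card G).

Section DisjointUnion.
Variables G1 G2 : sgraph.

Definition dunion_adj : rel (G1 + G2)%type := fun x y =>
  match x, y with
  | inl a, inl b => adj a b
  | inr a, inr b => adj a b
  | _, _ => false
  end.

Fact dunion_sym : symmetric dunion_adj.
Proof. by case=> x [] y //=; exact: adj_sym. Qed.

Fact dunion_irrefl : irreflexive dunion_adj.
Proof. by case=> x /=; exact: adj_irrefl. Qed.

Definition dunion : sgraph := SGraph dunion_sym dunion_irrefl.
End DisjointUnion.

Section Substitution.
Variables (G1 G2 : sgraph) (u : G1).

Definition subst_adj : rel ({x : G1 | x != u} + G2)%type := fun x y =>
  match x, y with
  | inl a, inl b => adj (val a) (val b)
  | inr a, inr b => adj a b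
  | inl a, inr _ => adj (val a) u
  | inr _, inl b => adj (val b) u
  end.

Fact subst_sym : symmetric subst_adj.
Proof. by case=> x [] y //=; exact: adj_sym. Qed.

Fact subst_irrefl : irreflexive subst_adj.
Proof. by case=> x /=; exact: adj_irrefl. Qed.

Definition substitute : sgraph := SGraph subst_sym subst_irrefl.
End Substitution.

(* The isomorphism rule is what lets vertex sets be made disjoint by taking
   copies, as [dunion] and [substitute] do through sum types. In [closure_subst] the
   graph [G1] is non-empty because it contains [u]. *)
Inductive sub_closure (C : sgraph -> Prop) : sgraph -> Prop :=
| closure_base G : C G -> sub_closure C G
| closure_iso G H : isomorphic G H -> sub_closure C G -> sub_closure C H
| closure_dunion G1 G2 :
    sub_closure C G1 -> sub_closure C G2 -> sub_closure C (dunion G1 G2)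
| closure_subst (G1 G2 : sgraph) (u : G1) :
    (0 < #|G2|)%N -> sub_closure C G1 -> sub_closure C G2 ->
    sub_closure C (substitute G2 u).

Definition chi_bounding (R : realType) (C : sgraph -> Prop) (f : nat -> R) :
  Prop :=
  forall G : sgraph, C G ->
  forall A : {set G}, (chi (induced A))%:R <= f (omega (induced A)).

Definition chi_bounded (R : realType) (C : sgraph -> Prop) : Prop :=
  exists f : nat -> R, chi_bounding C f.

Definition polynomial_fun (R : realType) (f : nat -> R) : Prop :=
  exists p : {poly R}, forall n, f n = p.[n%:R].

Definition poly_chi_bounded (R : realType) (C : sgraph -> Prop) : Prop :=
  exists2 f : nat -> R, polynomial_fun f & chi_bounding C f.

(* Main.v *)
Require Import Defs.
From mathcomp Require Import all_boot all_order all_algebra reals zify.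

Set Implicit Arguments.
Unset Strict Implicit.
Unset Printing Implicit Defensive.

Import Order.TTheory GRing.Theory Num.Theory.

(** Replace colorings by weighted multicolorings: a graph is [K]-multicolorable
    if, for all vertex weights [w] such that every clique has weight at most [W],
    one can give each vertex [v] a set of [w v ^ K] of the [W ^ K] colors, with
    disjoint sets on adjacent vertices.  0/1 weights give [chi <= omega ^ K] for
    all induced subgraphs.  The property passes to a substitution of [G2] for
    [u]: multicolor [G1] with [u] weighted by the maximal weight of a clique of
    [G2], and then multicolor [G2] inside the color set given to [u].

    It remains to see that [chi <= omega ^ k] for all induced subgraphs implies
    [K]-multicolorability with [K = 2 k + 3].  Cut the vertices into levels
    [W / 2 ^ (j+1) < w v <= W / 2 ^ j].  Cliques in level [j] have fewer than
    [2 ^ (j+1)] vertices, so for [j > 0] the level needs at most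
    [2 ^ (k (j+1)) * (W / 2 ^ j) ^ K <= W ^ K / 2 ^ (j+2)] colors, which are taken
    between [W ^ K / 2 ^ (j+2)] and [W ^ K / 2 ^ (j+1)].  Level 0 is a stable set,
    and its vertex [v] takes the last [w v ^ K] colors; they avoid the
    colors of a neighbor [u] in level [j], because
    [W ^ K - w v ^ K >= (W - w v) * W ^ (K-1) >= w u * W ^ (K-1) > W ^ K / 2 ^ (j+1)]. *)

Lemma leq_wexp2r e m n : m <= n -> m ^ e <= n ^ e.
Proof. by case: e => // e mn; rewrite leq_exp2r. Qed.

Lemma leq_mul_subn_exp a b n : b <= a -> (a - b) * a ^ n <= a ^ n.+1 - b ^ n.+1.
Proof.
by move=> ba; rewrite mulnBl -expnS leq_sub2l // expnS leq_mul2l leq_wexp2r ?orbT.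
Qed.

(** * Cliques and the chromatic number *)

Section Cliques.

Variable G : sgraph.
Implicit Types A B : {set G}.

Lemma cliqueP A :
  reflect {in A &, forall x y, x != y -> adj x y} (clique A).
Proof.
apply: (iffP forall_inP) => [h x y xA yA xy | h x xA].
  by move/forall_inP: (h x xA) => /(_ y yA)/implyP/(_ xy).
by apply/forall_inP => y yA; apply/implyP; exact: h.
Qed.

Lemma clique0 : @clique G set0.
Proof. by apply/cliqueP => x y; rewrite inE. Qed.

Lemma clique1 (x : G) : clique [set x].
Proof. by apply/cliqueP => y z /set1P-> /set1P->; rewrite eqxx. Qed.

Lemma clique2 (x y : G) : adj x y -> clique [set x; y].
Proof.
move=> xy; apply/cliqueP => a b /set2P[]-> /set2P[]->; rewrite ?eqxx // => _.
by rewrite adj_sym.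
Qed.

Lemma chi_le k : (chi G <= k) = colorable G k.
Proof.
rewrite /chi; case: ex_minnP => m /existsP[c /forallP cP] min_m.
apply/idP/idP => [le_mk | /min_m //].
apply/existsP; exists [ffun x => widen_ord le_mk (c x)].
apply/forallP => x; apply/forallP => y; rewrite !ffunE.
exact: (forallP (cP x)).
Qed.

End Cliques.

(** * Colorings of induced subgraphs and weights of cliques *)

Section CliqueWeight.

Variable G : sgraph.
Implicit Types A B : {set G}.

Lemma omega_induced_leP A n :
  reflect (forall B, B \subset A -> clique B -> #|B| <= n)
          (omega (induced A) <= n).
Proof.
apply: (iffP idP) => [le_n B /subsetP BA /cliqueP cB | h].
  pose B' : {set induced A} := [set x | val x \in B].
  have cB' : clique B'.
    apply/cliqueP => x y; rewrite !inE => xB yB xy; exact: cB.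
  apply: leq_trans le_n; apply: leq_trans (leq_bigmax_cond _ cB').
  suff -> : B = val @: B' by exact: leq_imset_card.
  apply/setP=> x; apply/idP/imsetP => [xB | [y]]; last by rewrite inE => ? ->.
  by exists (Sub x (BA x xB)); rewrite ?inE ?SubK.
apply/bigmax_leqP => B /cliqueP cB.
rewrite -(card_imset _ val_inj); apply: h.
  by apply/subsetP => _ /imsetP[x _ ->]; exact: valP.
apply/cliqueP => _ _ /imsetP[x xB ->] /imsetP[y yB ->].
by rewrite (inj_eq val_inj); exact: (cB x y).
Qed.

(** A coloring defined on all of [G] avoids subtypes, and the informative existential lets one
    coloring per level be extracted by projection. *)
Lemma chi_induced_coloring A k : chi (induced A) <= k ->
  {c : G -> nat | {in A, forall x, c x < k} &
                  {in A &, forall x y, adj x y -> c x != c y}}.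
Proof.
rewrite chi_le => /existsP/sigW[c /forallP cP].
exists (fun x => if insub x is Some y then val (c y) else 0) => [x xA | x y xA yA xy].
  by rewrite insubT ltn_ord.
rewrite !insubT; have /forallP/(_ (Sub y yA))/implyP := cP (Sub x xA).
exact.
Qed.

Lemma coloring_chi_induced A k (c : G -> nat) :
  {in A, forall x, c x < k} ->
  {in A &, forall x y, adj x y -> c x != c y} -> chi (induced A) <= k.
Proof.
move=> ck cP; rewrite chi_le; apply/existsP.
exists [ffun x => Ordinal (ck _ (valP x))].
apply/forallP => x; apply/forallP => y; apply/implyP => xy; rewrite !ffunE.
exact: (cP _ _ (valP x) (valP y) xy).
Qed.

Definition clique_weight (w : G -> nat) : nat :=
  \max_(A | clique A) \sum_(x in A) w x.

Lemma clique_weight_le w A : clique A -> \sum_(x in A) w x <= clique_weight w.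
Proof. by move=> cA; exact: (@leq_bigmax_cond _ _ (fun A => \sum_(x in A) w x) A cA). Qed.

Lemma clique_weightP w W :
  reflect (forall A, clique A -> \sum_(x in A) w x <= W) (clique_weight w <= W).
Proof. exact: bigmax_leqP. Qed.

Lemma clique_weight_attained w :
  exists2 A, clique A & clique_weight w = \sum_(x in A) w x.
Proof.
have [|A cA eA] := @eq_bigmax_cond _ [pred A | clique A] (fun A => \sum_(x in A) w x).
  by apply/card_gt0P; exists set0; exact: clique0.
by exists A; rewrite // -eA.
Qed.

Lemma clique_weight1 w x : w x <= clique_weight w.
Proof. by have := clique_weight_le w (clique1 x); rewrite big_set1. Qed.

Lemma clique_weight2 w x y : adj x y -> w x + w y <= clique_weight w.
Proof.
move=> xy; have := clique_weight_le w (clique2 xy).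
rewrite big_setU1 ?big_set1 // inE.
by apply: contraTneq xy => ->; rewrite adj_irrefl.
Qed.

End CliqueWeight.

(** * Weighted multicolorings and the closure operations *)

(* [phi x] enumerates the colors of [x]; its values from [w x ^ K] on are junk. *)
Definition multicolorable (K : nat) (G : sgraph) : Prop :=
  forall (w : G -> nat) (W : nat), clique_weight w <= W ->
  exists phi : G -> nat -> nat,
    [/\ forall x i, i < w x ^ K -> phi x i < W ^ K,
        forall x i i', i < w x ^ K -> i' < w x ^ K -> phi x i = phi x i' -> i = i' &
        forall x y i i', adj x y -> i < w x ^ K -> i' < w y ^ K ->
          phi x i <> phi y i'].

Lemma multicolorable_chi K (G : sgraph) (A : {set G}) : multicolorable K G ->
  chi (induced A) <= omega (induced A) ^ K.
Proof.
move=> mG; pose w x : nat := x \in A.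
have /mG[phi [phi_lt _ phi_adj]] : clique_weight w <= omega (induced A).
  apply/clique_weightP => B /cliqueP cB.
  have -> : \sum_(x in B) w x = #|B :&: A|.
    rewrite -sum1_card (big_setID A) /= [X in _ + X]big1 ?addn0.
      by apply: eq_bigr => x /setIP[_ xA]; rewrite /w xA.
    by move=> x /setDP[_ /negPf xA]; rewrite /w xA.
  apply: (omega_induced_leP A _ (leqnn _)) => //; first exact: subsetIr.
  by apply/cliqueP => x y /setIP[xB _] /setIP[yB _]; exact: cB.
have w1 x : x \in A -> 0 < w x ^ K by move=> xA; rewrite /w xA exp1n.
apply: (@coloring_chi_induced _ _ _ (fun x => phi x 0)) => [x xA | x y xA yA xy].
  by apply: phi_lt; exact: w1.
by apply/eqP/phi_adj; rewrite ?w1.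
Qed.

Lemma multicolorable_iso K G H :
  isomorphic G H -> multicolorable K G -> multicolorable K H.
Proof.
move=> [h [g hK gK] h_adj] mG w W wW.
have /mG[phi [phi_lt phi_inj phi_adj]] : clique_weight (w \o h) <= W.
  apply/clique_weightP => A /cliqueP cA.
  rewrite -(big_imset w) /=; last by move=> x y _ _; exact: (can_inj hK).
  apply: (clique_weightP _ _ wW); apply/cliqueP => _ _ /imsetP[x xA ->] /imsetP[y yA ->].
  by rewrite (inj_eq (can_inj hK)) h_adj; exact: cA.
have wE x : (w \o h) (g x) = w x by rewrite /= gK.
exists (phi \o g); split=> [x i | x i i' | x y i i' xy] /=.
- by rewrite -wE; exact: phi_lt.
- by rewrite -wE; exact: phi_inj.
- by rewrite -(wE x) -(wE y); apply: phi_adj; rewrite -h_adj !gK.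
Qed.

(** Both sides share the same [W ^ K] colors: no edge joins them, and a clique of either side is a
    clique of the union. *)
Lemma multicolorable_dunion K G1 G2 :
  multicolorable K G1 -> multicolorable K G2 -> multicolorable K (dunion G1 G2).
Proof.
move=> m1 m2 w W /clique_weightP wW.
have /m1[phi1 [lt1 inj1 adj1]] : clique_weight (fun x => w (inl x)) <= W.
  apply/clique_weightP => A /cliqueP cA.
  rewrite -(big_imset w) /=; last by move=> x y _ _ [].
  apply: wW; apply/cliqueP => _ _ /imsetP[x xA ->] /imsetP[y yA ->] xy.
  by apply: cA => //; apply: contra_neq xy => ->.
have /m2[phi2 [lt2 inj2 adj2]] : clique_weight (fun x => w (inr x)) <= W.
  apply/clique_weightP => A /cliqueP cA.
  rewrite -(big_imset w) /=; last by move=> x y _ _ [].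
  apply: wW; apply/cliqueP => _ _ /imsetP[x xA ->] /imsetP[y yA ->] xy.
  by apply: cA => //; apply: contra_neq xy => ->.
exists (fun x => match x with inl a => phi1 a | inr b => phi2 b end).
split=> [[] x i | [] x i i' | [] x [] y i i' //].
- exact: lt1.
- exact: lt2.
- exact: inj1.
- exact: inj2.
- exact: adj1.
- exact: adj2.
Qed.

Lemma multicolorable_substitute K (G1 G2 : sgraph) (u : G1) :
  multicolorable K G1 -> multicolorable K G2 ->
  multicolorable K (substitute G2 u).
Proof.
move=> m1 m2 w W /clique_weightP wW.
pose w2 (y : G2) := w (inr y); pose W2 := clique_weight w2.
(* [insub x] fails exactly at [u], which therefore gets weight [W2]. *)
pose w1 x : nat := if insub x is Some a then w (inl a) else W2.
have w1l (a : {x | x != u}) : w1 (val a) = w (inl a) by rewrite /w1 valK.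
have w1u : w1 u = W2 by rewrite /w1 insubF // eqxx.
have [phi2 [lt2 inj2 adj2]] := m2 w2 W2 (leqnn _).
have /m1[phi1 [lt1 inj1 adj1]] : clique_weight w1 <= W.
  apply/clique_weightP => A /cliqueP cA.
  have [A2 /cliqueP cA2 W2E] := clique_weight_attained w2.
  (* If [u] lies in [A], it is replaced by a heaviest clique [A2] of [G2]; the weight of [B] under
     [w] is that of [A] under [w1]. *)
  pose B : {set substitute G2 u} := [set x | match x with
    | inl a => val a \in A | inr b => (u \in A) && (b \in A2) end].
  have /wW : clique B.
    apply/cliqueP => -[a|a] [b|b]; rewrite !inE.
    - by move=> aA bA ab; apply: cA => //; apply: contra_neq ab => /val_inj->.
    - by move=> aA /andP[uA _] _; exact: cA (valP a).
    - by move=> /andP[uA _] bA _; exact: cA (valP b).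
    - by move=> /andP[_ aA] /andP[_ bA] ab; apply: cA2 => //; apply: contra_neq ab => ->.
  apply: leq_trans; rewrite big_sumType /= addnC.
  rewrite (bigID (pred1 u)) /=; apply: leq_add.
    case uA: (u \in A).
      rewrite (big_pred1 u) => [|x]; last by rewrite /=; case: eqP => [->|]; rewrite ?uA ?andbF.
      rewrite w1u /W2 W2E; apply: eq_leq; apply: eq_bigl => b.
      by rewrite inE uA.
    by rewrite big_pred0 // => x; case: eqP => [->|]; rewrite ?uA ?andbF.
  rewrite (reindex_omap (val : {x | x != u} -> G1) insub) /=; last first.
    by move=> x /andP[_ xu]; rewrite insubT.
  apply: eq_leq; apply: eq_big => [a | a _]; last exact: w1l.
  by rewrite inE valK eqxx (valP a) !andbT.
have lt2u y i : i < w2 y ^ K -> phi2 y i < w1 u ^ K.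
  by rewrite w1u; exact: lt2.
(* Since [phi2 b i] is below [W2 ^ K = w1 u ^ K], it indexes a color of [u]. *)
exists (fun x => match x with inl a => phi1 (val a)
                            | inr b => fun i => phi1 u (phi2 b i) end).
split=> [[x|x] i | [x|x] i i' | [x|x] [y|y] i i' xy]; rewrite -?w1l.
- exact: lt1.
- by move/lt2u; exact: lt1.
- exact: inj1.
- move=> ix ix' /inj1 e; apply: (inj2 x) => //; apply: e; exact: lt2u.
- exact: adj1.
- by move=> ix /lt2u; exact: adj1.
- by move=> /lt2u iy ix; apply: adj1 => //; rewrite adj_sym.
- by move=> ix iy /inj1 e; apply: (adj2 x y i i') => //; apply: e; exact: lt2u.
Qed.

(** * From a power bound on [chi] to multicolorings *)

Lemma multicolorable_of_chi k (G : sgraph) :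
  (forall A : {set G}, chi (induced A) <= omega (induced A) ^ k) ->
  multicolorable (2 * k + 3) G.
Proof.
set K := 2 * k + 3 => chiG w W wW.
(* At weight 0 this is a junk value; such vertices lie in no [L j] and, as [K > 0], have no
   colors. *)
pose lev x := trunc_log 2 (W %/ w x).
have w_gt0 x i : i < w x ^ K -> 0 < w x by case: (w x) => //; rewrite exp0n // /K addn3.
have levP x : 0 < w x -> 2 ^ lev x * w x <= W < 2 ^ (lev x).+1 * w x.
  move=> x0; have xW := leq_trans (clique_weight1 w x) wW.
  have /(trunc_log_bounds (isT : 1 < 2)) : 0 < W %/ w x by rewrite divn_gt0.
  by rewrite /= -/(lev x) leq_divRL // ltn_divLR.
pose L j : {set G} := [set x | (0 < w x) && (lev x == j)].
have omegaL j : omega (induced (L j)) <= 2 ^ j.+1.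
  apply/omega_induced_leP => B /subsetP BL cB.
  have sumW := leq_trans (clique_weight_le w cB) wW.
  (* The factor [W.+1] is positive even for [W = 0], and absorbs the strict bound:
     [W.+1 <= 2 ^ j.+1 * w x] for each [x] in [B]. *)
  rewrite -(leq_pmul2r (ltn0Sn W)).
  apply: leq_trans (_ : 2 ^ j.+1 * \sum_(x in B) w x <= _); last first.
    by rewrite leq_mul2l (leq_trans sumW) ?orbT.
  rewrite -sum_nat_const big_distrr /=; apply: leq_sum => x /BL.
  by rewrite inE => /andP[/levP/andP[_ xW] /eqP <-].
have chiL j : chi (induced (L j)) <= 2 ^ (k * j.+1).
  apply: leq_trans (chiG _) _; rewrite mulnC expnM.
  by apply: leq_wexp2r.
pose c j := s2val (chi_induced_coloring (chiL j)).
have c_lt x : 0 < w x -> c (lev x) x < 2 ^ (k * (lev x).+1).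
  by move=> x0; apply: (s2valP (chi_induced_coloring (chiL (lev x)))); rewrite inE x0 eqxx.
have c_adj x y : 0 < w x -> 0 < w y -> lev x = lev y -> adj x y ->
    c (lev x) x != c (lev x) y.
  move=> x0 y0 xy; apply: (s2valP' (chi_induced_coloring (chiL (lev x)))).
    by rewrite inE x0 eqxx.
  by rewrite inE y0 xy eqxx.
pose cut j := W ^ K %/ 2 ^ j.+1.
pose M j := (W %/ 2 ^ j) ^ K.
have wM x : 0 < w x -> w x ^ K <= M (lev x).
  move=> /levP/andP[xW _]; apply: leq_wexp2r.
  by rewrite leq_divRL ?expn_gt0 // mulnC.
(* In a positive level, the class [c (lev x) x] selects a block of [M (lev x)] consecutive colors,
   enough for [w x ^ K] by [wM]. *)
pose phi x i := if lev x == 0 then W ^ K - w x ^ K + i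
                else cut (lev x).+1 + (c (lev x) x * M (lev x) + i).
have cutM j : 0 < j -> 2 ^ (k * j.+1) * M j <= cut j.+1.
  move=> j0; rewrite leq_divRL ?expn_gt0 //.
  have : 2 ^ (j * K) * M j <= W ^ K.
    by rewrite expnM -expnMn leq_wexp2r // mulnC leq_divM.
  apply: leq_trans; rewrite mulnAC -expnD leq_mul2r leq_exp2l //.
  (* This asks for [k * (j + 1) + (j + 2) <= j * K]; equality at [j = 1] dictates
     [K = 2 * k + 3]. *)
  by apply/orP; right; rewrite /K; nia.
have cutS j : 2 * cut j.+1 <= cut j.
  by rewrite /cut leq_divRL ?expn_gt0 // mulnC mulnA -expnSr mulnC leq_divM.
have cut_le j j' : j <= j' -> cut j' <= cut j.
  by move=> jj; rewrite leq_div2l ?expn_gt0 // leq_exp2l.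
have phi_light x i : 0 < lev x -> i < w x ^ K ->
    cut (lev x).+1 <= phi x i < cut (lev x).
  move=> x0 ix; have x_gt0 := w_gt0 _ _ ix.
  rewrite /phi (gtn_eqF x0) leq_addr /=.
  (* The blocks fill at most [cut (lev x).+1] colors from [cut (lev x).+1] on, hence end by
     [cut (lev x)]. *)
  have := c_lt x x_gt0; have := wM x x_gt0; have := cutM _ x0; have := cutS (lev x).
  nia.
have phi_heavy x y i i' : lev x = 0 -> 0 < lev y -> adj x y ->
    i < w x ^ K -> i' < w y ^ K -> phi y i' < phi x i.
  move=> x0 y0 xy ix iy; have [_ yl] := andP (phi_light _ _ y0 iy).
  apply: leq_trans yl _; rewrite /phi x0 eqxx.
  apply: leq_trans (leq_addr _ _).
  have sxy := leq_trans (clique_weight2 w xy) wW.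
  have [_ lyW] := andP (levP y (w_gt0 _ _ iy)).
  have -> : K = (2 * k + 2).+1 by rewrite /K; lia.
  apply: leq_trans (leq_mul_subn_exp _ _); last by lia.
  apply: leq_trans (_ : w y * W ^ (2 * k + 2) <= _); last first.
    by rewrite leq_mul2r; apply/orP; right; lia.
  rewrite /cut; have -> : K = (2 * k + 2).+1 by rewrite /K; lia.
  apply: leq_trans (leq_div2r _ (_ : _ <= (w y * W ^ (2 * k + 2)) * 2 ^ (lev y).+1)) _.
    by rewrite [W ^ _]expnS [leqRHS]mulnAC leq_mul2r [w y * _]mulnC (ltnW lyW) orbT.
  by rewrite mulnK ?expn_gt0.
exists phi; split=> [x i ix | x i i' ix ix' | x y i i' xy ix iy].
- have [x0|x0] := posnP (lev x).
    have xW : w x ^ K <= W ^ K.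
      by apply: leq_wexp2r; exact: leq_trans (clique_weight1 w x) wW.
    by rewrite /phi x0 eqxx; lia.
  have /andP[_] := phi_light _ _ x0 ix.
  by move/leq_trans; apply; exact: leq_div.
- by rewrite /phi; case: ifP => _; lia.
- have [x0|x0] := posnP (lev x); have [y0|y0] := posnP (lev y).
  (* Two adjacent vertices of weight above [W / 2] would form a clique heavier than [W]. *)
  + have := leq_trans (clique_weight2 w xy) wW.
    have := levP x (w_gt0 _ _ ix); have := levP y (w_gt0 _ _ iy).
    by rewrite x0 y0; lia.
  + by apply/eqP; rewrite gtn_eqF // phi_heavy.
  + by apply/eqP; rewrite ltn_eqF // phi_heavy // adj_sym.
  have /andP[xl xu] := phi_light _ _ x0 ix.
  have /andP[yl yu] := phi_light _ _ y0 iy.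
  case: (ltngtP (lev x) (lev y)) => [/cut_le|/cut_le|exy]; try by lia.
  have /eqP cxy := c_adj _ _ (w_gt0 _ _ ix) (w_gt0 _ _ iy) exy xy.
  rewrite /phi -exy (gtn_eqF x0) => /addnI.
  have iM := leq_trans ix (wM _ (w_gt0 _ _ ix)).
  have := leq_trans iy (wM _ (w_gt0 _ _ iy)); rewrite -exy => iM' e.
  have M0 := leq_ltn_trans (leq0n _) iM; apply: cxy.
  (* Dividing by the block length recovers the class of each vertex. *)
  by have := congr1 (divn^~ (M (lev x))) e; rewrite !divnMDl // !divn_small ?addn0.
Qed.

(** * From polynomial bounds to powers, and conclusion *)

(** With [s] the sum of the absolute values of the coefficients, [p] is at most [s * n ^ size p],
    and [n >= 2] lets a power of [n] absorb [s], because [m < n ^ m]. *)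
Lemma poly_natr_le (R : realType) (p : {poly R}) :
  exists k, forall n, 1 < n -> (p.[n%:R] <= (n ^ k)%:R)%R.
Proof.
pose s : R := (\sum_(i < size p) `|p`_i|)%R.
exists (Num.bound s + size p) => n n1.
have n0 : (0 <= n%:R :> R)%R by exact: ler0n.
apply: (@le_trans _ _ (s * (n ^ size p)%:R)%R).
  rewrite horner_coef mulr_suml; apply: ler_sum => i _.
  apply: le_trans (ler_norm _) _; rewrite normrM normrX (ger0_norm n0) -natrX.
  by rewrite ler_wpM2l // ler_nat leq_pexp2l // 1?ltnW.
rewrite expnD natrM ler_wpM2r ?ler0n //.
have s0 : (0 <= s)%R by apply: sumr_ge0.
apply/ltW/(lt_le_trans (archi_boundP s0)).
by rewrite ler_nat ltnW // ltn_expl.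
Qed.

(** Such a graph has no edges, so one color suffices, or none if it is empty. This covers the values
    of [omega] that [poly_natr_le] leaves out. *)
Lemma chi_le_omega (G : sgraph) : omega G <= 1 -> chi G <= omega G.
Proof.
move=> om1.
have no_adj (x y : G) : adj x y = false.
  apply: contraTF om1 => xy; rewrite -ltnNge.
  have := @leq_bigmax_cond _ _ (fun A : {set G} => #|A|) _ (clique2 xy).
  by rewrite cards2; case: eqP xy => [->|//]; rewrite adj_irrefl.
have x_om (x : G) : 0 < omega G.
  by have := @leq_bigmax_cond _ _ (fun A : {set G} => #|A|) _ (clique1 x); rewrite cards1.
rewrite chi_le; apply/existsP.
exists [ffun x => Ordinal (x_om x)].
by apply/forallP => x; apply/forallP => y; rewrite no_adj.
Qed.

Theorem theorem2p3 (R : realType) (C : sgraph -> Prop) :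
  chi_bounded R C -> poly_chi_bounded R C -> poly_chi_bounded R (sub_closure C).
Proof.
move=> _ [f [p fp] chif].
have [k0 pk0] := poly_natr_le p; pose k := k0.+1.
pose K := 2 * k + 3.
have mC G : sub_closure C G -> multicolorable K G.
  elim=> {G} [G CG | G H GH _ | G1 G2 _ m1 _ m2 | G1 G2 u _ _ m1 _ m2].
  - apply: multicolorable_of_chi => A.
    have [om1|om1] := leqP (omega (induced A)) 1.
      apply: leq_trans (chi_le_omega om1) _.
      by case: (omega _) => // m; rewrite -[leqLHS]expn1 leq_pexp2l.
    rewrite -(ler_nat R); apply: le_trans (chif G CG A) _; rewrite fp.
    apply: le_trans (pk0 _ om1) _.
    by rewrite ler_nat leq_pexp2l // ltnW.
  - exact: multicolorable_iso.
  - exact: multicolorable_dunion.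
  - exact: multicolorable_substitute.
exists (fun n => (n ^ K)%:R)%R => [|G /mC mG A].
  by exists 'X^K%R => n; rewrite hornerXn natrX.
by rewrite ler_nat; exact: multicolorable_chi.
Qed.
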